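(* For any cardinal $\alpha$, there exists an isometric SPR embedding of $\ell_\infty(\alpha)$ into itself; that is, there is a linear isometry $J:\ell_\infty(\alpha)\to\ell_\infty(\alpha)$ (not necessarily onto) whose range does stable phase retrieval in $\ell_\infty(\alpha)$.
   Context: $\ell_\infty(\alpha)$ is the real Banach lattice of bounded real functions on a set of cardinality $\alpha$, with supremum norm and pointwise order. A subspace $E$ of a real Banach lattice $X$ does stable phase retrieval (SPR) if there is a constant $C$ such that $\min_{\lambda\in\{1,-1\}}\|f-\lambda g\|\leq C\big\||f|-|g|\big\|$ for all $f,g\in E$.
   Formalization: The cardinal α is assumed to be infinite or at most 1; for finite α ≥ 2 the claim is false, since a linear isometry is then onto and e1+e2, e1−e2 have equal modulus without agreeing up to sign. *)

(* Defs.v *)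
From HB Require Import structures.
From mathcomp Require Import all_boot all_order all_algebra.
From mathcomp Require Import all_classical all_reals.
From mathcomp Require Import topology normedtype.
Set Implicit Arguments.
Unset Strict Implicit.
Unset Printing Implicit Defensive.
Import Order.TTheory GRing.Theory Num.Theory.
Import numFieldNormedType.Exports.
Local Open Scope classical_set_scope.
Local Open Scope ring_scope.

(* The order is a field of the mixin because HB cannot join latticeType with
   lmodType once the numeric domains, which inherit from both, are declared.
   Meets need no field: the meet of x and y is - vjoin (- x) (- y). *)
HB.mixin Record isBanachLattice (R : realType) V
    & CompleteNormedModule R V := {
  vle : V -> V -> Prop;
  vjoin : V -> V -> V;
  vle_refl : forall x, vle x x;
  vle_anti : forall x y, vle x y -> vle y x -> x = y;
  vle_trans : forall y x z, vle x y -> vle y z -> vle x z;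
  vjoin_le : forall x y z, vle (vjoin x y) z <-> vle x z /\ vle y z;
  vle_add2l : forall z x y, vle x y -> vle (z + x) (z + y);
  vle_wpscale : forall (a : R) x y, 0 <= a -> vle x y -> vle (a *: x) (a *: y);
  vle_norm : forall x y, vle (vjoin x (- x)) (vjoin y (- y)) -> `|x| <= `|y|
}.

#[short(type="banachLatticeType")]
HB.structure Definition BanachLattice (R : realType) :=
  {V of CompleteNormedModule R V & isBanachLattice R V}.

(* The modulus of a vector lattice; `|x| always denotes the norm. *)
Definition lmod (R : realType) (X : banachLatticeType R) (x : X) : X :=
  vjoin x (- x).

(* f - lambda g for lambda in {1, -1} is f - g or f + g. *)
Definition does_SPR (R : realType) (X : banachLatticeType R) (E : set X) :=
  submod_closed [in E] /\
  exists C : R, forall f g : X, E f -> E g ->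
    Num.min `|f - g| `|f + g| <= C * `|lmod f - lmod g|.

Section ell_infty.
Variables (R : realType) (T : Type).

Definition bounded_pred : {pred T -> R} := mem (bounded_fun : set (T -> R)).

Lemma bounded_predP (f : T -> R) :
  reflect (exists M : R, forall t, `|f t| <= M) (f \in bounded_pred).
Proof.
apply: (iffP idP) => [|[M fM]]; rewrite /bounded_pred !inE /=.
  by move=> /pinfty_ex_gt0[M _ fM]; exists M => t; exact: fM.
rewrite /bounded_near; near=> N => t _; rewrite /= (le_trans (fM t))//.
by near: N; apply: nbhs_pinfty_ge; exact: num_real.
Unshelve. all: by end_near. Qed.

Lemma bounded_submod : subsemimod_closed bounded_pred.
Proof.
split; [split|].
- by apply/bounded_predP; exists 0 => t; rewrite normr0.
- move=> f g /bounded_predP[M fM] /bounded_predP[N gN].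
  apply/bounded_predP; exists (M + N) => t.
  by rewrite (le_trans (ler_normD _ _))// lerD.
- move=> a f /bounded_predP[M fM]; apply/bounded_predP; exists (`|a| * M) => t.
  by rewrite normrM ler_wpM2l.
Qed.

HB.instance Definition _ :=
  GRing.isSubmodClosed.Build R (T -> R) bounded_pred bounded_submod.

Lemma bounded_max (f g : T -> R) : f \in bounded_pred -> g \in bounded_pred ->
  (fun t => Num.max (f t) (g t)) \in bounded_pred.
Proof.
move=> /bounded_predP[M fM] /bounded_predP[N gN].
apply/bounded_predP; exists (M + N) => t.
have M0 := le_trans (normr_ge0 _) (fM t).
have N0 := le_trans (normr_ge0 _) (gN t).
case: (leP (f t) (g t)) => _.
  by rewrite (le_trans (gN t))// lerDr.
by rewrite (le_trans (fM t))// lerDl.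
Qed.

Record ell_infty := EllInfty {
  ell_fun :> T -> R;
  ell_bounded : ell_fun \in bounded_pred
}.

HB.instance Definition _ := [isSub of ell_infty for ell_fun].
HB.instance Definition _ := [Choice of ell_infty by <:].
HB.instance Definition _ := [SubChoice_isSubLmodule of ell_infty by <:].

Implicit Types f g : ell_infty.

Lemma ell_infty_ext f g : (forall t, f t = g t) -> f = g.
Proof. by move=> fg; apply/val_inj/funext. Qed.

Lemma ell_addE f g t : (f + g) t = f t + g t. Proof. by []. Qed.
Lemma ell_oppE f t : (- f) t = - f t. Proof. by []. Qed.
Lemma ell_subE f g t : (f - g) t = f t - g t. Proof. by []. Qed.
Lemma ell_scaleE (a : R) f t : (a *: f) t = a * f t. Proof. by []. Qed.

(* For empty T this is sup set0 = 0. *)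
Definition ell_norm f : R := sup (range (fun t => `|f t|)).

Lemma ell_norm_has_ubound f : has_ubound (range (fun t => `|f t|)).
Proof.
have /bounded_predP[M fM] := ell_bounded f.
by exists M => _ [t _ <-].
Qed.

Lemma ell_norm_ge f t : `|f t| <= ell_norm f.
Proof. by apply: ub_le_sup; [exact: ell_norm_has_ubound|exists t]. Qed.

Lemma ell_norm_ge0 f : 0 <= ell_norm f.
Proof.
have [f0|/set0P[_ [t _ _]]] := eqVneq (range (fun t => `|f t|)) set0.
  by rewrite /ell_norm f0 sup0.
by rewrite (le_trans _ (ell_norm_ge f t)).
Qed.

Lemma ell_norm_le f (M : R) :
  0 <= M -> (forall t, `|f t| <= M) -> ell_norm f <= M.
Proof.
move=> M0 fM; have [f0|/set0P f0] := eqVneq (range (fun t => `|f t|)) set0.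
  by rewrite /ell_norm f0 sup0.
by apply: ge_sup => // _ [t _ <-].
Qed.

Fact ell_norm_triangle f g : ell_norm (f + g) <= ell_norm f + ell_norm g.
Proof.
apply: ell_norm_le => [|t]; first by rewrite addr_ge0// ell_norm_ge0.
by rewrite ell_addE (le_trans (ler_normD _ _))// lerD// ell_norm_ge.
Qed.

Fact ell_normZ (a : R) f : ell_norm (a *: f) = `|a| * ell_norm f.
Proof.
have le b h : ell_norm (b *: h) <= `|b| * ell_norm h.
  apply: ell_norm_le => [|t]; first by rewrite mulr_ge0// ell_norm_ge0.
  by rewrite ell_scaleE normrM ler_wpM2l// ell_norm_ge.
apply/eqP; rewrite eq_le le /=; have [->|a0] := eqVneq a 0.
  by rewrite normr0 mul0r ell_norm_ge0.
rewrite -ler_pdivlMl ?normr_gt0// -normfV.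
by rewrite -[in leLHS](scale1r f) -(mulVf a0) -scalerA le.
Qed.

Fact ell_norm_eq0 f : ell_norm f = 0 -> f = 0.
Proof.
move=> f0; apply: ell_infty_ext => t.
by apply/eqP; rewrite -normr_le0 -f0 ell_norm_ge.
Qed.

HB.instance Definition _ := Lmodule_isNormed.Build R ell_infty
  ell_norm_triangle ell_normZ ell_norm_eq0.

Lemma ell_normE f : `|f| = sup (range (fun t => `|f t|)).
Proof. by []. Qed.

Fact ell_complete (F : set_system ell_infty) :
  ProperFilter F -> cauchy F -> cvg F.
Proof.
move=> FF Fc.
have Fc' (e : R) : 0 < e -> \forall f \near F & g \near F, ell_norm (f - g) < e.
  move=> e0; have /cauchy_ballP/(_ _ e0) := Fc.
  by apply: filterS => -[f g]; rewrite -ball_normE.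
have ev_cvg t : cvg ((fun f => f t) @ F).
  apply/cauchy_cvgP/cauchy_ballP => e e0.
  have := Fc' _ e0 => -[[A B] /= [FA FB] AB].
  exists (((fun f => f t) @` A), ((fun f => f t) @` B)).
    by split; [apply: filterS FA|apply: filterS FB] => h ?; exists h.
  move=> [_ _] /= [[f Af <-] [g Bg <-]].
  rewrite -ball_normE /= -ell_subE.
  exact: le_lt_trans (ell_norm_ge _ _) (AB (f, g) (conj Af Bg)).
pose l t : R := lim ((fun f => f t) @ F).
have lP (e : R) : 0 < e -> F [set f | forall t, `|l t - f t| <= e].
  move=> e0; have := Fc' _ e0 => /nearP_dep.
  apply: filterS => f /= fF t.
  have cvgn : (fun h : ell_infty => `|h t - f t|) @ F --> `|l t - f t|.
    by apply: cvg_norm; apply: cvgB; [exact: ev_cvg|exact: cvg_cst].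
  rewrite -(cvg_lim (@Rhausdorff R) cvgn).
  apply: limr_le; first exact: cvgP cvgn.
  apply: filterS fF => h hf; rewrite -ell_subE (le_trans (ell_norm_ge _ _))//.
  by rewrite -[leLHS]/(`|h - f|) distrC ltW.
have lb : l \in bounded_pred.
  have := lP 1 ltr01 => /(@filter_ex _ _ _) [f fl].
  have /bounded_predP[M fM] := ell_bounded f.
  apply/bounded_predP; exists (1 + M) => t.
  by rewrite -(subrK (f t) (l t)) (le_trans (ler_normD _ _))// lerD.
apply/cvg_ex; exists (EllInfty lb); apply/cvgrPdist_le => e e0.
apply: filterS (lP _ e0) => f fl.
by apply: ell_norm_le => //; exact: ltW.
Qed.

HB.instance Definition _ := Uniform_isComplete.Build ell_infty ell_complete.

Definition ell_le f g := forall t, f t <= g t.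
Definition ell_join f g : ell_infty :=
  EllInfty (bounded_max (ell_bounded f) (ell_bounded g)).

Fact ell_le_refl f : ell_le f f. Proof. by move=> t. Qed.

Fact ell_le_anti f g : ell_le f g -> ell_le g f -> f = g.
Proof.
by move=> fg gf; apply: ell_infty_ext => t; apply: le_anti; rewrite fg gf.
Qed.

Fact ell_le_trans g f h : ell_le f g -> ell_le g h -> ell_le f h.
Proof. by move=> fg gh t; exact: le_trans (fg t) (gh t). Qed.

Fact ell_join_le f g h : ell_le (ell_join f g) h <-> ell_le f h /\ ell_le g h.
Proof.
split=> [fgh|[fh gh] t]; last by rewrite /= ge_max fh gh.
by split=> t; have := fgh t; rewrite /= ge_max => /andP[].
Qed.

Fact ell_le_add2l h f g : ell_le f g -> ell_le (h + f) (h + g).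
Proof. by move=> fg t; rewrite !ell_addE lerD2l. Qed.

Fact ell_le_wpscale (a : R) f g : 0 <= a -> ell_le f g ->
  ell_le (a *: f) (a *: g).
Proof. by move=> a0 fg t; rewrite !ell_scaleE ler_wpM2l. Qed.

Fact ell_le_norm f g :
  ell_le (ell_join f (- f)) (ell_join g (- g)) -> `|f| <= `|g|.
Proof.
move=> fg; apply: ell_norm_le => // t; apply: le_trans (ell_norm_ge g t).
by have := fg t; rewrite /= !maxrN.
Qed.

HB.instance Definition _ := isBanachLattice.Build R ell_infty
  ell_le_refl ell_le_anti ell_le_trans ell_join_le
  ell_le_add2l ell_le_wpscale ell_le_norm.

Lemma ell_lmodE f t : lmod f t = `|f t|.
Proof. by rewrite /lmod /= maxrN. Qed.

End ell_infty.

(* Main.v *)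
Require Import Defs.
From HB Require Import structures.
From mathcomp Require Import all_boot all_order all_algebra.
From mathcomp Require Import all_classical all_reals.
From mathcomp Require Import topology normedtype.
From mathcomp Require Import lra.
Import Order.TTheory GRing.Theory Num.Theory.
Import numFieldNormedType.Exports.
Local Open Scope classical_set_scope.
Local Open Scope ring_scope.

(** The embedding lists all the means of two coordinates.  Let e be a map of T
    onto T * T, and let the coordinate of J f at t be (f r + f s) / 2, where
    (r, s) = e t.  Means do not exceed the norm of f, and the diagonal pairs give
    back the coordinates of f, so J is an isometry.

    For phase retrieval, let d be the norm of |J f| - |J g|.  The diagonal pairs
    show that, up to an error d, f s is g s or - g s at each s; what remains is
    that the choice of sign can be made uniformly.  If it cannot, there are s and
    t with f s close to - g s but not to g s, and f t close to g t but not to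
    - g t, so that f s and f t are both large compared with d.  Then f s + f t
    and g s + g t are close to f s + f t and - f s + f t, whose moduli differ by
    twice the smaller of |f s| and |f t|; but the entry of J at the pair (s, t)
    makes this difference small.  Keeping track of the errors gives the constant
    C = 5 (sign_agreement, pair_mean_SPR).

    A map of T onto T * T is trivial to find if T has at most one point.  For
    infinite T it is the equality of an infinite cardinal with its square
    (infinite_square_card_le).  This rests on Zorn's lemma, applied to the subsets
    A of T equipped with a coding of A * A in A, and on the comparability of
    cardinals (card_le_total): a maximal A cannot inject into its complement,
    hence it is large enough to absorb the complement. *)

(** * Comparability of cardinals *)

Lemma chain_bigcup2 {T : Type} (F : set (set T)) p q :
    total_on F subset -> (\bigcup_(X in F) X) p -> (\bigcup_(X in F) X) q ->
  exists X, [/\ F X, X p & X q].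
Proof.
move=> Ftot [X FX Xp] [Y FY Yq]; have [XY|YX] := Ftot _ _ FX FY.
  by exists Y; split=> //; exact: XY.
by exists X; split=> //; exact: YX.
Qed.

Lemma card_le_rel {T U : Type} (A : set T) (B : set U) (G : T -> U -> Prop) :
    (forall x, A x -> exists2 y, B y & G x y) ->
    (forall x x' y, A x -> A x' -> G x y -> G x' y -> x = x') ->
  (A #<= B)%card.
Proof.
move=> Gtot Ginj; elim/Ppointed: U => U in B G Gtot Ginj *.
  suff -> : A = set0 by [].
  by rewrite -subset0 => x /Gtot[y]; case: (no y).
have /choice[f fP] x : exists y, A x -> B y /\ G x y.
  by have [/Gtot[y]|] := pselect (A x); [exists y|exists point].
apply/pcard_leP/injfunPex; exists f => [x /fP[]//|x y].
rewrite !inE => Ax Ay fxy; have [_ Gx] := fP _ Ax; have [_ Gy] := fP _ Ay.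
by apply: Ginj Gx _ => //; rewrite fxy.
Qed.

(** A maximal partial bijection between A and B exhausts one of them, since
    otherwise one more pair could be added. *)
Lemma card_le_total {T U : Type} (A : set T) (B : set U) :
  (A #<= B)%card \/ (B #<= A)%card.
Proof.
pose P (G : set (T * U)) := [/\ G `<=` A `*` B,
  forall x y y', G (x, y) -> G (x, y') -> y = y' &
  forall x x' y, G (x, y) -> G (x', y) -> x = x'].
have [F FP Ftot|G [[GAB Gfun Ginj] Gmax]] := @Zorn_bigcup _ P.
  split=> [p [X /FP[+ _ _]]|x y y' xy xy'|x x' y xy x'y]; first exact.
    have [X [/FP[_ Xfun _] Xxy Xxy']] := chain_bigcup2 _ _ _ Ftot xy xy'.
    exact: Xfun Xxy Xxy'.
  have [X [/FP[_ _ Xinj] Xxy Xx'y]] := chain_bigcup2 _ _ _ Ftot xy x'y.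
  exact: Xinj Xxy Xx'y.
have [domA|] := pselect (forall x, A x -> exists y, G (x, y)).
  left; apply: (@card_le_rel _ _ A B (fun x y => G (x, y))); last first.
    by move=> x x' y _ _; exact: Ginj.
  by move=> x /domA[y Gxy]; exists y => //; exact: (GAB _ Gxy).2.
have [ranB _|] := pselect (forall y, B y -> exists x, G (x, y)).
  right; apply: (@card_le_rel _ _ B A (fun y x => G (x, y))); last first.
    by move=> y y' x _ _; exact: Gfun.
  by move=> y /ranB[x Gxy]; exists x => //; exact: (GAB _ Gxy).1.
move=> /existsNP[y0 /not_implyP[By0 /forallNP Gy0]].
move=> /existsNP[x0 /not_implyP[Ax0 /forallNP Gx0]].
exfalso; apply: (Gmax (G `|` [set (x0, y0)])).
  by split=> [p Gp|/(_ (x0, y0) (or_intror erefl)) /Gx0//]; left.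
split=> [_ [/GAB//|->//]|x y y'|x x' y].
- move=> [xy|[-> ->]] [xy'|[]]; first exact: Gfun xy xy'.
  + by move=> xE; rewrite xE in xy; case: (Gx0 _ xy).
  + by case: (Gx0 _ xy').
  + by [].
- move=> [xy|[-> ->]] [x'y|[]]; first exact: Ginj xy x'y.
  + by move=> _ yE; rewrite yE in xy; case: (Gy0 _ xy).
  + by case: (Gy0 _ x'y).
  + by [].
Qed.

(** * The square of an infinite cardinal *)

(** The candidate subsets of the exhaustion, together with their codings of
    pairs, are stored as a single graph, so that extension is mere inclusion and
    the form of Zorn's lemma for sets of sets applies.  The subset is read off
    from the graph itself: it consists of the x for which (x, x) has a code. *)
Definition pairing_base {T : Type} (G : set (T * T * T)) : set T :=
  [set x | exists z, G (x, x, z)].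

(** A pair may have several codes.  Only decoding has to be unambiguous, because
    what the graph witnesses is that the square of its base is no larger than
    the base. *)
Definition pairing_graph {T : Type} (G : set (T * T * T)) :=
  [/\ forall x y z, G (x, y, z) ->
        [/\ pairing_base G x, pairing_base G y & pairing_base G z],
      forall x y, pairing_base G x -> pairing_base G y -> exists z, G (x, y, z) &
      forall p q z, G (p, z) -> G (q, z) -> p = q].

Lemma pairing_graph_bigcup {T : Type} (F : set (set (T * T * T))) :
    F `<=` pairing_graph -> total_on F subset ->
  pairing_graph (\bigcup_(X in F) X).
Proof.
move=> FP Ftot; split=> [x y z [X FX Xxyz]|x y [z xz] [t yt]|p q z pz qz].
- by have [/(_ _ _ _ Xxyz)[[a ?] [b ?] [c ?]] _ _] := FP _ FX;
    split; [exists a|exists b|exists c]; exists X.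
- have [X [FX Xx Xy]] := chain_bigcup2 _ _ _ Ftot xz yt.
  have [_ tot _] := FP _ FX.
  by have [| |w Xw] := tot x y; [exists z|exists t|exists w; exists X].
- have [X [FX Xp Xq]] := chain_bigcup2 _ _ _ Ftot pz qz.
  have [_ _ inj] := FP _ FX; exact: inj Xp Xq.
Qed.

(** The countable start of the exhaustion, from a bijection of nat * nat with
    nat transported along u. *)
Lemma pairing_graph_range {T : Type} (u : nat -> T) : injective u ->
  pairing_graph [set (u i, u j, u (pickle (i, j))) | i in setT & j in setT].
Proof.
move=> u_inj; set G := [set _ | _ in _ & _ in _].
have diagG i : pairing_base G (u i).
  by exists (u (pickle (i, i))); exists i => //; exists i.
split=> [_ _ _ [i _ [j _ [<- <- <-]]]|_ _ [_ [i _ [? _ [<- _ _]]]]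
    [_ [j _ [? _ [<- _ _]]]]|_ _ _ [i _ [j _ [<- <-]]] [k _ [l _ [<-]]]].
- by [].
- by exists (u (pickle (i, j))); exists i => //; exists j.
- by move=> /u_inj/(pcan_inj pickleK)[-> ->].
Qed.

Lemma pairing_graph_fun {T : Type} (G : set (T * T * T))
    (A := pairing_base G) :
  pairing_graph G ->
  exists f : T -> T -> T,
    [/\ forall x y, A x -> A y -> G (x, y, f x y),
        forall x y, A x -> A y -> A (f x y) &
        forall x y x' y', A x -> A y -> A x' -> A y' ->
          f x y = f x' y' -> x = x' /\ y = y'].
Proof.
move=> [Gdiag Gtot Ginj].
have [f fP] : exists f, forall x y, A x -> A y -> G (x, y, f x y).
  have /choice[f fP] p : exists z, A p.1 -> A p.2 -> G (p, z).
    have [[Ax Ay]|nA] := pselect (A p.1 /\ A p.2);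
      last by exists p.1 => Ax Ay; case: nA.
    by have [z] := Gtot _ _ Ax Ay; case: p Ax Ay => x y *; exists z.
  by exists (fun x y => f (x, y)) => x y Ax Ay; exact: (fP (x, y)).
exists f; split=> [//|x y Ax Ay|x y x' y' Ax Ay Ax' Ay' eqf].
  by have [] := Gdiag _ _ _ (fP _ _ Ax Ay).
have := fP _ _ Ax Ay; rewrite eqf => Gxy.
by case: (Ginj _ _ _ Gxy (fP _ _ Ax' Ay')).
Qed.

(** If the base A of G has a disjoint copy i(A), then G is not maximal.  The new
    pairs over the union of A and i(A) form three copies of A * A, which f maps
    into three copies of A; a second use of f, against a constant u n naming the
    copy, puts these side by side in A, and i moves the result to i(A), where no
    old code lies. *)
Lemma pairing_graph_extend {T : Type} (G : set (T * T * T))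
    (u : nat -> T) (i : T -> T) :
    pairing_graph G -> injective u -> (forall n, pairing_base G (u n)) ->
    (forall x, pairing_base G x -> ~ pairing_base G (i x)) ->
    (forall x y, pairing_base G x -> pairing_base G y -> i x = i y -> x = y) ->
  exists2 G', G `<` G' & pairing_graph G'.
Proof.
move=> GP u_inj uG iG i_inj; have [Gdiag _ Ginj] := GP.
set A := pairing_base G in uG iG i_inj.
have [f [fP fA f_inj]] := pairing_graph_fun _ GP.
(* The flag b tells whether an element lies in A or in its copy. *)
pose copy (b : bool) x := if b then i x else x.
have ffA x y n : A x -> A y -> A (f (f x y) (u n)).
  by move=> Ax Ay; exact: (fA _ _ (fA _ _ Ax Ay) (uG n)).
pose code (b b' : bool) x y := i (f (f x y) (u (pickle (b, b')))).
have codeN b b' x y : A x -> A y -> ~ A (code b b' x y).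
  by move=> Ax Ay; apply: iG; exact: ffA.
pose New : set (T * T * T) := [set p | exists b b' x y,
  [/\ b || b', A x, A y &
      p = (copy b x, copy b' y, code b b' x y)]].
pose G' := G `|` New.
have diagG' b x : A x -> pairing_base G' (copy b x).
  case: b => Ax /=; last by case: Ax => z; exists z; left.
  by exists (code true true x x); right; exists true, true, x, x.
have diagG'P x : pairing_base G' x -> exists b a, A a /\ x = copy b a.
  move=> [z [Gx|[b [b' [a [a' [_ Aa _ [-> _]]]]]]]]; last by exists b, a.
  by exists false, x; split=> //; exists z.
exists G'.
  split=> [p Gp|/(_ (i (u 0%N), i (u 0%N), code true true (u 0%N) (u 0%N)))].
    by left.
  case/(_ _)/Gdiag => [|/(iG _ (uG 0%N))//].
  by right; exists true, true, (u 0%N), (u 0%N).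
split=> [x y z|x y /diagG'P[b [a [Aa ->]]] /diagG'P[b' [a' [Aa' ->]]]|p q z].
- case=> [/Gdiag[Ax Ay Az]|[b [b' [a [a' [_ Aa Aa' [-> -> ->]]]]]]].
    by split; exact: (diagG' false).
  split; [exact: diagG'|exact: diagG'|].
  by apply: (diagG' true); exact: ffA.
- have [bb'|] := boolP (b || b').
    by exists (code b b' a a'); right; exists b, b', a, a'.
  by case: b b' => -[] // _; exists (f a a'); left; exact: fP.
- move=> [Gp|[b [b' [a [a' [_ Aa Aa' [pE zE]]]]]]].
    move=> [Gq|[b [b' [a [a' [_ Aa Aa' [_ zE]]]]]]]; first exact: Ginj Gp Gq.
    by case: p Gp => x y /Gdiag[_ _ Az];
      case: (codeN b b' a a' Aa Aa'); rewrite -zE.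
  move=> [Gq|[c [c' [d [d' [_ Ad Ad' [qE zE']]]]]]].
    by case: q Gq => x y /Gdiag[_ _ Az];
      case: (codeN b b' a a' Aa Aa'); rewrite -zE.
  rewrite pE qE; move: zE; rewrite zE'.
  move=> /(i_inj _ _ (ffA _ _ _ Ad Ad') (ffA _ _ _ Aa Aa')).
  move=> /(f_inj _ _ _ _ (fA _ _ Ad Ad') (uG _) (fA _ _ Aa Aa') (uG _))[].
  move=> /(f_inj _ _ _ _ Ad Ad' Aa Aa')[-> ->].
  by move=> /u_inj/(pcan_inj pickleK)[-> ->].
Qed.

(** A maximal coded subset A, with complement B.  An injection of A into B would
    allow an extension; so B injects into A, hence T injects into two disjoint
    copies of A inside A, and the pairing on A codes the pairs of T. *)
Lemma infinite_square_card_le (T : Type) :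
  infinite_set [set: T] -> ([set: T * T] #<= [set: T])%card.
Proof.
elim/Ppointed: T => T; first by rewrite emptyE => /(_ (finite_set0 _)).
move=> /infiniteP/ppcard_leP/unsquash u'.
have [u u_inj] : exists u : nat -> T, injective u by exists u'; exact: injT.
pose G0 := [set (u i, u j, u (pickle (i, j))) | i in setT & j in setT].
(* Zorn's lemma starts from the empty union of graphs, so the countable start
   is imposed on nonempty graphs only and recovered from maximality below. *)
pose P (G : set (T * T * T)) := pairing_graph G /\ (G !=set0 -> G0 `<=` G).
have [F FP Ftot|G [[GP GG0] Gmax]] := @Zorn_bigcup _ P.
  split=> [|[p [X FX Xp]]].
    by apply: pairing_graph_bigcup => // X /FP[].
  by have [_ /(_ (ex_intro _ _ Xp)) G0X] := FP _ FX; move=> q /G0X; exists X.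
have G0P : P G0 by split=> [|_]; first exact: pairing_graph_range u_inj.
have {}GG0 : G0 `<=` G.
  have [GE|/set0P/GG0//] := eqVneq G set0; exfalso; apply: Gmax G0P.
  rewrite GE; split=> // /(_ (u 0%N, u 0%N, u (pickle (0%N, 0%N)))).
  by apply; exists 0%N => //; exists 0%N.
set A := pairing_base G.
have uA n : A (u n).
  by exists (u (pickle (n, n))); apply: GG0; exists n => //; exists n.
have [/pcard_leP/injfunPex[i iA i_inj]|/pcard_leP/injfunPex[h hA hinj]] :=
  card_le_total A (~` A).
  have [x Ax|x y Ax Ay|G' GG' G'P] := @pairing_graph_extend _ _ u i GP u_inj uA.
  - exact: iA.
  - by apply: i_inj; rewrite inE.
  - exfalso; apply: (Gmax _ GG'); split=> // _.
    exact: subset_trans GG0 (properW GG').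
have [f [_ fA f_inj]] := pairing_graph_fun _ GP.
have h_inj x y : ~ A x -> ~ A y -> h x = h y -> x = y.
  by move=> nAx nAy; apply: hinj; rewrite inE.
have f_u x y m n : A x -> A y -> f x (u m) = f y (u n) -> x = y /\ m = n.
  by move=> Ax Ay /(f_inj _ _ _ _ Ax (uA m) Ay (uA n))[-> /u_inj].
(* The second arguments u 0 and u 1 keep A and its complement apart. *)
pose q x := if `[< A x >] then f x (u 0%N) else f (h x) (u 1%N).
have qA x : A (q x).
  rewrite /q; case: asboolP => [Ax|/hA Ahx]; first exact: (fA _ _ Ax (uA _)).
  exact: (fA _ _ Ahx (uA _)).
have q_inj : injective q.
  move=> x y; rewrite /q; case: asboolP => [Ax|nAx]; case: asboolP => [Ay|nAy].
  - by move=> /(f_u _ _ _ _ Ax Ay)[].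
  - by move=> /(f_u _ _ _ _ Ax (hA _ nAy))[].
  - by move=> /(f_u _ _ _ _ (hA _ nAx) Ay)[].
  - by move=> /(f_u _ _ _ _ (hA _ nAx) (hA _ nAy))[/h_inj->].
have [_ Gtot Ginj] := GP.
apply: (@card_le_rel _ _ _ _ (fun p z => G (q p.1, q p.2, z))) => [[x y] _|].
  by have [z Gz] := Gtot _ _ (qA x) (qA y); exists z.
by move=> [x y] [x' y'] z _ _ Gz /(Ginj _ _ _ Gz)[/q_inj -> /q_inj ->].
Qed.

Lemma ex_square_surj (T : Type) :
    infinite_set [set: T] \/ is_subset1 [set: T] ->
  exists e : T -> T * T, forall p, exists t, e t = p.
Proof.
case=> [/infinite_square_card_le|T1]; last first.
  exists (fun t => (t, t)) => -[s t]; exists s.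
  by congr (_, _); exact: T1.
elim/Ppointed: T => T; first by exists (fun t => (t, t)) => -[s]; case: (no s).
move=> /pcard_surjP[e esurj]; exists e => p.
by have [t _ <-] := esurj p I; exists t.
Qed.

(** * The embedding by means of two coordinates *)

Lemma abs_sub_or_add_le {R : realDomainType} (a b d : R) :
  `| `|a| - `|b| | <= d -> `|a - b| <= d \/ `|a + b| <= d.
Proof.
case: (ger0P a) => _; case: (ger0P b) => _.
- by move=> h; left.
- by rewrite opprK => h; right.
- by rewrite -normrN opprD !opprK => h; right.
- by rewrite -normrN opprD !opprK => h; left.
Qed.

(** Up to the error d, b is a or - a and b' is a' or - a'; only the case of b near
    - a and b' near a' needs an argument.  Then |a + a'| and |b + b'| are close to
    |a' + a| and |a' - a|, two numbers that differ by twice the smaller of |a| and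
    |a'|.  So a or a' is small, and with it a - b or a' + b'. *)
Lemma sign_agreement {R : realFieldType} (a b a' b' d : R) :
    `| `|a| - `|b| | <= d -> `| `|a'| - `|b'| | <= d ->
    `| `|a + a'| - `|b + b'| | <= 2 * d ->
  `|a - b| <= 5 * d \/ `|a' + b'| <= 5 * d.
Proof.
move=> hd hd' hdd'; have d0 : 0 <= d by apply: le_trans hd.
have [ab|ab] := abs_sub_or_add_le _ _ _ hd; first by left; lra.
have [ab'|ab'] := abs_sub_or_add_le _ _ _ hd'; last by right; lra.
have := abs_sub_or_add_le _ _ _ hdd'.
rewrite !ler_norml in ab ab' *.
move=> [|] h; [left|right]; lra.
Qed.

Lemma ell_mean_le {R : realType} {T : Type} (f : ell_infty R T) s t :
  `|(f s + f t) / 2| <= `|f|.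
Proof.
have := ell_norm_ge f s; have := ell_norm_ge f t.
rewrite -[ell_norm f]/(`|f|) !ler_norml; lra.
Qed.

Lemma pair_mean_bounded {R : realType} {T : Type} (e : T -> T * T)
    (f : ell_infty R T) :
  (fun t => (f (e t).1 + f (e t).2) / 2) \in @bounded_pred R T.
Proof. by apply/bounded_predP; exists `|f| => t; exact: ell_mean_le. Qed.

Definition pair_mean {R : realType} {T : Type} (e : T -> T * T)
    (f : ell_infty R T) : ell_infty R T :=
  EllInfty (pair_mean_bounded e f).

Lemma pair_mean_linear {R : realType} {T : Type} (e : T -> T * T) :
  linear (@pair_mean R T e).
Proof.
move=> a f g; apply: ell_infty_ext => t.
rewrite ell_addE ell_scaleE /=.
set s := (e t).1; set r := (e t).2.
rewrite -[LHS]/((a * f s + g s + (a * f r + g r)) / 2); lra.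
Qed.

HB.instance Definition _ (R : realType) (T : Type) (e : T -> T * T) :=
  GRing.isLinear.Build R (ell_infty R T) (ell_infty R T) _ (pair_mean e)
    (pair_mean_linear e).

Lemma pair_mean_diag {R : realType} {T : Type} (e : T -> T * T)
    (f : ell_infty R T) s :
  (forall p, exists t, e t = p) -> exists t, pair_mean e f t = f s.
Proof. by move=> /(_ (s, s))[t et]; exists t; rewrite /= et /=; lra. Qed.

Lemma pair_mean_isometry {R : realType} {T : Type} (e : T -> T * T)
    (f : ell_infty R T) :
  (forall p, exists t, e t = p) -> `|pair_mean e f| = `|f|.
Proof.
move=> e_surj; apply/le_anti/andP; split; apply: ell_norm_le => // s.
  exact: ell_mean_le.
by have [t <-] := pair_mean_diag e f s e_surj; exact: ell_norm_ge.
Qed.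

(** With C = 5.  A coordinate s at which f and g are far apart is compared with
    every other coordinate t through the entry of index (s, t). *)
Lemma pair_mean_SPR {R : realType} {T : Type} (e : T -> T * T) :
  (forall p, exists t, e t = p) -> does_SPR (range (@pair_mean R T e)).
Proof.
move=> e_surj; split.
  split=> [|a _ _ /set_mem[f _ <-] /set_mem[g _ <-]]; apply: mem_set.
    by exists 0; rewrite ?linear0.
  by exists (a *: f + g); rewrite ?linearP.
exists 5 => _ _ [f _ <-] [g _ <-].
set d := `|lmod _ - lmod _|.
have dP t : `| `|pair_mean e f t| - `|pair_mean e g t| | <= d.
  have := ell_norm_ge (lmod (pair_mean e f) - lmod (pair_mean e g)) t.
  by rewrite ell_subE !ell_lmodE.
have d1 s : `| `|f s| - `|g s| | <= d.
  have [t et] := e_surj (s, s); have := dP t.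
  by rewrite /= et /= !mulrDl -!splitr.
have d2 s t : `| `|f s + f t| - `|g s + g t| | <= 2 * d.
  have [r er] := e_surj (s, t); have := dP r.
  rewrite /= er /= !normrM -mulrBl normrM.
  by rewrite !(ger0_norm (_ : 0 <= 2^-1 :> R)) ?invr_ge0// ler_pdivrMr// mulrC.
rewrite -linearB -linearD !pair_mean_isometry// ge_min.
have d0 : 0 <= d by exact: normr_ge0.
have [fg|/existsNP[s fgs]] := pselect (forall s, `|f s - g s| <= 5 * d).
  by apply/orP; left; apply: ell_norm_le; rewrite ?mulr_ge0.
apply/orP; right; apply: ell_norm_le => [|t]; rewrite ?mulr_ge0//.
by have [//|] := sign_agreement _ _ _ _ _ (d1 s) (d1 t) (d2 s t).
Qed.

(* The set T plays the role of the cardinal.  Finite cardinals >= 2 have to be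
   excluded: there a linear isometry of ell_infty R T into itself is onto, and
   the whole space does not do SPR (for s <> t, the vectors e_s + e_t and
   e_s - e_t have the same modulus). *)
Theorem lemma4p4 (R : realType) (T : Type)
    (hT : infinite_set [set: T] \/ is_subset1 [set: T]) :
  exists J : {linear ell_infty R T -> ell_infty R T},
    (forall f : ell_infty R T, `|J f| = `|f|) /\ does_SPR (range J).
Proof.
have [e e_surj] := ex_square_surj T hT.
exists (pair_mean e : {linear ell_infty R T -> ell_infty R T}).
by split=> [f|]; [exact: pair_mean_isometry|exact: pair_mean_SPR].
Qed.
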